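(* Let $G$ be a group, let $X$ and $S$ be schemes equipped with actions of $G$, and let $X \to S$ be a $G$-equivariant morphism of schemes that is of finite type. Suppose that $S$ is topologically $G$-noetherian. Then $X$ is topologically $G$-noetherian.
   Context: A group $G$ (an arbitrary abstract group) acts on a scheme by scheme automorphisms. A topological space $T$ with an action of $G$ (by homeomorphisms) is called $G$-noetherian if every descending chain of $G$-stable closed subsets of $T$ stabilizes. A scheme $X$ with an action of $G$ is called topologically $G$-noetherian if its underlying topological space $|X|$ is $G$-noetherian. No noetherian or other finiteness hypotheses are imposed on the schemes beyond those stated. *)

(* Defs.v *)
From HB Require Import structures.
From mathcomp Require Import all_boot all_algebra generic_quotient ring.
From mathcomp Require Import all_classical topology.

Set Implicit Arguments.
Unset Strict Implicit.
Unset Printing Implicit Defensive.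

Import GRing.Theory.

Local Open Scope classical_set_scope.
Local Open Scope ring_scope.
Local Open Scope quotient_scope.

(* Rings are commutative and possibly zero (comPzRingType), since the        *)
(* sections over the empty open set form the zero ring. MathComp's           *)
(* prime_idealr is only defined over nonzero rings, hence prime_ideal.       *)

Section PrimeIdeal.
Variable A : comPzRingType.

Definition prime_ideal (I : set A) : Prop :=
  [/\ I 0, forall x y, I x -> I y -> I (x + y),
      forall a x, I x -> I (a * x),
      ~ I 1 & forall x y, I (x * y) -> I x \/ I y].

Record spec : Type := Spec {
  spec_ideal :> A -> Prop;
  specP : prime_ideal spec_ideal }.

HB.instance Definition _ := gen_eqMixin spec.
HB.instance Definition _ := gen_choiceMixin spec.

Lemma specM (p : spec) x y : ~ p x -> ~ p y -> ~ p (x * y).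
Proof. by case: (specP p) => _ _ _ _ pM px py /pM[]. Qed.

Lemma spec1 (p : spec) : ~ p 1.
Proof. by case: (specP p). Qed.

End PrimeIdeal.

(** ** The localization of a ring at a prime ideal *)

Section Localization.
Variables (A : comPzRingType) (p : spec A).

Record fraction : Type := Fraction { num : A; den : A; denP : ~ p den }.

HB.instance Definition _ := gen_eqMixin fraction.
HB.instance Definition _ := gen_choiceMixin fraction.

Definition fraction_equiv (x y : fraction) : bool :=
  `[< exists2 t, ~ p t & t * (num x * den y) = t * (num y * den x) >].

Lemma fraction_equiv_refl : reflexive fraction_equiv.
Proof. by move=> x; apply/asboolP; exists 1 => //; exact: spec1. Qed.

Lemma fraction_equiv_sym : symmetric fraction_equiv.
Proof.
by move=> x y; apply/asboolP/asboolP => -[t pt e]; exists t => //; rewrite e.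
Qed.

Lemma fraction_equiv_trans : transitive fraction_equiv.
Proof.
move=> y x z /asboolP[t pt e] /asboolP[u pu f]; apply/asboolP.
exists (t * u * den y); first by apply: specM (@denP y); exact: specM.
transitivity (u * den z * (t * (num x * den y))); first by ring.
rewrite e; transitivity (t * den x * (u * (num y * den z))); first by ring.
by rewrite f; ring.
Qed.

Canonical fraction_equivRel := EquivRel fraction_equiv
  fraction_equiv_refl fraction_equiv_sym fraction_equiv_trans.

Definition localization : Type := {eq_quot fraction_equiv}.

HB.instance Definition _ : EqQuotient _ fraction_equiv localization :=
  EqQuotient.on localization.
HB.instance Definition _ := Choice.on localization.

Definition mkloc (a f : A) (pf : ~ p f) : localization :=
  \pi_localization (Fraction a pf).

Lemma mklocE a f (pf : ~ p f) b g (pg : ~ p g) :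
  mkloc a pf = mkloc b pg <-> exists2 t, ~ p t & t * (a * g) = t * (b * f).
Proof.
rewrite /mkloc; split=> [/eqmodP/asboolP//|h]; exact/eqmodP/asboolP.
Qed.

Lemma mklocP (x : localization) : exists a f (pf : ~ p f), x = mkloc a pf.
Proof.
by elim/quotW: x => -[a f pf]; exists a, f, pf.
Qed.

Definition add_fraction (x y : fraction) : fraction :=
  Fraction (num x * den y + num y * den x) (specM (@denP x) (@denP y)).
Definition opp_fraction (x : fraction) : fraction :=
  Fraction (- num x) (@denP x).
Definition mul_fraction (x y : fraction) : fraction :=
  Fraction (num x * num y) (specM (@denP x) (@denP y)).

Definition add_loc (x y : localization) : localization :=
  \pi_localization (add_fraction (repr x) (repr y)).
Definition opp_loc (x : localization) : localization :=
  \pi_localization (opp_fraction (repr x)).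
Definition mul_loc (x y : localization) : localization :=
  \pi_localization (mul_fraction (repr x) (repr y)).

Lemma repr_mkloc a f (pf : ~ p f) :
  exists2 t, ~ p t &
    t * (num (repr (mkloc a pf)) * f) = t * (a * den (repr (mkloc a pf))).
Proof.
have : \pi_localization (repr (mkloc a pf)) = \pi_localization (Fraction a pf).
  by rewrite reprK.
by move=> /eqmodP/asboolP.
Qed.

Lemma add_mkloc a f (pf : ~ p f) b g (pg : ~ p g) :
  add_loc (mkloc a pf) (mkloc b pg) = mkloc (a * g + b * f) (specM pf pg).
Proof.
have [t pt e] := repr_mkloc a pf; have [u pu h] := repr_mkloc b pg.
apply/mklocE; exists (t * u); first exact: specM.
set x := repr _ in e *; set y := repr _ in h *.
transitivity (u * den y * g * (t * (num x * f)) +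
              t * den x * f * (u * (num y * g))); first by ring.
by rewrite e h; ring.
Qed.

Lemma opp_mkloc a f (pf : ~ p f) : opp_loc (mkloc a pf) = mkloc (- a) pf.
Proof.
have [t pt e] := repr_mkloc a pf; apply/mklocE; exists t => //.
by rewrite !mulNr !mulrN e.
Qed.

Lemma mul_mkloc a f (pf : ~ p f) b g (pg : ~ p g) :
  mul_loc (mkloc a pf) (mkloc b pg) = mkloc (a * b) (specM pf pg).
Proof.
have [t pt e] := repr_mkloc a pf; have [u pu h] := repr_mkloc b pg.
apply/mklocE; exists (t * u); first exact: specM.
set x := repr _ in e *; set y := repr _ in h *.
transitivity ((t * (num x * f)) * (u * (num y * g))); first by ring.
by rewrite e h; ring.
Qed.

Fact eq_mkloc a f (pf : ~ p f) b g (pg : ~ p g) :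
  a * g = b * f -> mkloc a pf = mkloc b pg.
Proof. by move=> e; apply/mklocE; exists 1; [exact: spec1 | rewrite e]. Qed.

Fact add_locA : associative add_loc.
Proof.
move=> x y z; have [a [f [pf ->]]] := mklocP x.
have [b [g [pg ->]]] := mklocP y; have [c [h [ph ->]]] := mklocP z.
by rewrite !add_mkloc; apply: eq_mkloc; ring.
Qed.

Fact add_locC : commutative add_loc.
Proof.
move=> x y; have [a [f [pf ->]]] := mklocP x.
by have [b [g [pg ->]]] := mklocP y; rewrite !add_mkloc; apply: eq_mkloc; ring.
Qed.

Fact add_loc0 : left_id (mkloc 0 (@spec1 _ p)) add_loc.
Proof.
move=> x; have [a [f [pf ->]]] := mklocP x.
by rewrite add_mkloc; apply: eq_mkloc; ring.
Qed.

Fact add_locN : left_inverse (mkloc 0 (@spec1 _ p)) opp_loc add_loc.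
Proof.
move=> x; have [a [f [pf ->]]] := mklocP x.
by rewrite opp_mkloc add_mkloc; apply: eq_mkloc; ring.
Qed.

HB.instance Definition _ := GRing.isZmodule.Build localization
  add_locA add_locC add_loc0 add_locN.

Fact mul_locA : associative mul_loc.
Proof.
move=> x y z; have [a [f [pf ->]]] := mklocP x.
have [b [g [pg ->]]] := mklocP y; have [c [h [ph ->]]] := mklocP z.
by rewrite !mul_mkloc; apply: eq_mkloc; ring.
Qed.

Fact mul_locC : commutative mul_loc.
Proof.
move=> x y; have [a [f [pf ->]]] := mklocP x.
by have [b [g [pg ->]]] := mklocP y; rewrite !mul_mkloc; apply: eq_mkloc; ring.
Qed.

Fact mul_loc1 : left_id (mkloc 1 (@spec1 _ p)) mul_loc.
Proof.
move=> x; have [a [f [pf ->]]] := mklocP x.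
by rewrite mul_mkloc; apply: eq_mkloc; ring.
Qed.

Fact mul_locDl : left_distributive mul_loc add_loc.
Proof.
move=> x y z; have [a [f [pf ->]]] := mklocP x.
have [b [g [pg ->]]] := mklocP y; have [c [h [ph ->]]] := mklocP z.
by rewrite !(mul_mkloc, add_mkloc); apply: eq_mkloc; ring.
Qed.

HB.instance Definition _ := GRing.Zmodule_isComPzRing.Build localization
  mul_locA mul_locC mul_loc1 mul_locDl.

End Localization.

(** ** Ringed spaces *)

Record opens (T : topologicalType) : Type := Opens {
  opens_set :> T -> Prop;
  opensP : open opens_set }.

Definition opensI (T : topologicalType) (U V : opens T) : opens T :=
  Opens (openI (opensP U) (opensP V)).

Lemma preim_open (T T' : topologicalType) (f : T -> T') (cf : continuous f)
  (V : opens T') : open (f @^-1` V).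
Proof. by apply: open_comp (opensP V) => x _; exact: cf. Qed.

Definition opens_preim (T T' : topologicalType) (f : T -> T')
    (cf : continuous f) (V : opens T') : opens T :=
  Opens (preim_open cf V).

Record ringed_space : Type := RingedSpace {
  rs_top :> topologicalType;
  sec : opens rs_top -> comPzRingType;
  res : forall U V : opens rs_top, V `<=` U -> {rmorphism sec U -> sec V};
  res_id : forall (U : opens rs_top) (h : U `<=` U) (s : sec U), res h s = s;
  res_comp : forall (U V W : opens rs_top) (hVU : V `<=` U) (hWV : W `<=` V)
    (hWU : W `<=` U) (s : sec U), res hWV (res hVU s) = res hWU s;
  sec_glue : forall (I : Type) (U : I -> opens rs_top) (V : opens rs_top)
    (hU : forall i, U i `<=` V) (s : forall i, sec (U i)),
    V `<=` \bigcup_i U i ->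
    (forall i j, res (@subIsetl _ (U i) (U j) : opensI (U i) (U j) `<=` U i) (s i) =
                 res (@subIsetr _ (U i) (U j) : opensI (U i) (U j) `<=` U j) (s j)) ->
    exists! t : sec V, forall i, res (hU i) t = s i }.

(** ** The spectrum of a ring *)

Section Zariski.
Variable A : comPzRingType.

(* The complement of the closed set V(E) of the primes containing E. *)
Definition zariski_open (U : set (spec A)) : Prop :=
  exists E : set A, U = [set p | exists2 f, E f & ~ p f].

Fact zariski_openT : zariski_open setT.
Proof.
exists setT; rewrite eqEsubset; split=> p //= _.
by exists 1 => //; exact: spec1.
Qed.

Fact zariski_openI : setI_closed zariski_open.
Proof.
move=> _ _ [E ->] [F ->].
exists [set h | exists f g, [/\ E f, F g & h = f * g]].
rewrite eqEsubset; split=> p /=.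
  move=> [[f Ef pf] [g Fg pg]]; exists (f * g); last exact: specM.
  by exists f, g.
move=> [_ [f [g [Ef Fg ->]]] pfg].
have [_ _ pM _ _] := specP p.
split; [exists f | exists g] => // h; apply: pfg; last exact: pM.
by rewrite mulrC; exact: pM.
Qed.

Fact zariski_open_bigU (I : Type) (f : I -> set (spec A)) :
  (forall i, zariski_open (f i)) -> zariski_open (\bigcup_i f i).
Proof.
move=> fo; exists [set h | exists i, forall p : spec A, ~ p h -> f i p].
rewrite eqEsubset; split=> p /=.
  move=> [i _]; have [E fE] := fo i; rewrite {1}fE /= => -[h Eh ph].
  by exists h => //; exists i => q qh; rewrite fE; exists h.
by move=> [h [i fi] ph]; exists i => //; exact: fi.
Qed.

HB.instance Definition _ := isOpenTopological.Build (spec A)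
  zariski_openT zariski_openI zariski_open_bigU.

Lemma open_specE (U : set (spec A)) : open U = zariski_open U.
Proof. by []. Qed.

(* A section of the structure sheaf over U is a function s assigning to each *)
(* p in U an element of A_p, which is locally a fraction: each p in U has a  *)
(* neighbourhood V in U with a, f in A such that f is not in q and s(q) = a/f *)
(* for all q in V.                                                           *)
Definition locally_fraction (U : opens (spec A))
    (s : forall p : spec A, U p -> localization p) : Prop :=
  forall p : spec A, U p -> exists V : opens (spec A),
    [/\ V p, V `<=` U & exists a f : A,
      forall (q : spec A) (Uq : U q), V q ->
        exists qf : ~ q f, s q Uq = mkloc a qf].

Record spec_sec (U : opens (spec A)) : Type := SpecSec {
  spec_sec_fun :> forall p : spec A, U p -> localization p;
  spec_secP : locally_fraction spec_sec_fun }.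

Section Sections.
Variable U : opens (spec A).

HB.instance Definition _ := gen_eqMixin (spec_sec U).
HB.instance Definition _ := gen_choiceMixin (spec_sec U).

Lemma spec_sec_ext (s t : spec_sec U) :
  (forall p (Up : U p), s p Up = t p Up) -> s = t.
Proof.
case: s t => [s sP] [t tP] /= st.
have e : s = t by apply: functional_extensionality_dep => p;
  apply: functional_extensionality_dep => Up.
by subst t; congr SpecSec; exact: Prop_irrelevance.
Qed.

Fact spec_sec_cstP (a : A) :
  locally_fraction (fun p (_ : U p) => mkloc a (@spec1 _ p)).
Proof.
move=> p Up; exists U; split=> //; exists a, 1 => q _ Uq.
by exists (@spec1 _ q).
Qed.

Fact spec_sec_addP (s t : spec_sec U) :
  locally_fraction (fun p Up => s p Up + t p Up).
Proof.
move=> p Up; have [V [Vp VU [a [f sf]]]] := spec_secP s Up.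
have [W [Wp WU [b [g tg]]]] := spec_secP t Up.
exists (opensI V W); split=> [//|q [] /VU//|]; exists (a * g + b * f), (f * g).
move=> q Uq [/(sf _ Uq)[qf ->] /(tg _ Uq)[qg ->]].
by exists (specM qf qg); exact: add_mkloc.
Qed.

Fact spec_sec_oppP (s : spec_sec U) :
  locally_fraction (fun p Up => - s p Up).
Proof.
move=> p Up; have [V [Vp VU [a [f sf]]]] := spec_secP s Up.
exists V; split=> //; exists (- a), f => q Uq /(sf _ Uq)[qf ->].
by exists qf; exact: opp_mkloc.
Qed.

Fact spec_sec_mulP (s t : spec_sec U) :
  locally_fraction (fun p Up => s p Up * t p Up).
Proof.
move=> p Up; have [V [Vp VU [a [f sf]]]] := spec_secP s Up.
have [W [Wp WU [b [g tg]]]] := spec_secP t Up.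
exists (opensI V W); split=> [//|q [] /VU//|]; exists (a * b), (f * g).
move=> q Uq [/(sf _ Uq)[qf ->] /(tg _ Uq)[qg ->]].
by exists (specM qf qg); exact: mul_mkloc.
Qed.

Definition spec_sec_cst (a : A) : spec_sec U := SpecSec (spec_sec_cstP a).
Definition spec_sec_add (s t : spec_sec U) : spec_sec U :=
  SpecSec (spec_sec_addP s t).
Definition spec_sec_opp (s : spec_sec U) : spec_sec U :=
  SpecSec (spec_sec_oppP s).
Definition spec_sec_mul (s t : spec_sec U) : spec_sec U :=
  SpecSec (spec_sec_mulP s t).

Fact spec_sec_addA : associative spec_sec_add.
Proof. by move=> r s t; apply: spec_sec_ext => p Up; exact: addrA. Qed.

Fact spec_sec_addC : commutative spec_sec_add.
Proof. by move=> s t; apply: spec_sec_ext => p Up; exact: addrC. Qed.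

Fact spec_sec_add0 : left_id (spec_sec_cst 0) spec_sec_add.
Proof. by move=> s; apply: spec_sec_ext => p Up; exact: add0r. Qed.

Fact spec_sec_addN : left_inverse (spec_sec_cst 0) spec_sec_opp spec_sec_add.
Proof. by move=> s; apply: spec_sec_ext => p Up; exact: addNr. Qed.

HB.instance Definition _ := GRing.isZmodule.Build (spec_sec U)
  spec_sec_addA spec_sec_addC spec_sec_add0 spec_sec_addN.

Fact spec_sec_mulA : associative spec_sec_mul.
Proof. by move=> r s t; apply: spec_sec_ext => p Up; exact: mulrA. Qed.

Fact spec_sec_mulC : commutative spec_sec_mul.
Proof. by move=> s t; apply: spec_sec_ext => p Up; exact: mulrC. Qed.

Fact spec_sec_mul1 : left_id (spec_sec_cst 1) spec_sec_mul.
Proof. by move=> s; apply: spec_sec_ext => p Up; exact: mul1r. Qed.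

Fact spec_sec_mulDl : left_distributive spec_sec_mul spec_sec_add.
Proof. by move=> r s t; apply: spec_sec_ext => p Up; exact: mulrDl. Qed.

HB.instance Definition _ := GRing.Zmodule_isComPzRing.Build (spec_sec U)
  spec_sec_mulA spec_sec_mulC spec_sec_mul1 spec_sec_mulDl.

End Sections.

Section Restriction.
Variables (U V : opens (spec A)) (VU : V `<=` U).

Fact spec_res_subproof (s : spec_sec U) :
  locally_fraction (fun p (Vp : V p) => s p (VU Vp)).
Proof.
move=> p Vp; have [W [Wp WU [a [f sf]]]] := spec_secP s (VU Vp).
exists (opensI W V); split=> [//|q []//|]; exists a, f => q Vq [Wq _].
exact: sf.
Qed.

Definition spec_res (s : spec_sec U) : spec_sec V :=
  SpecSec (spec_res_subproof s).

Fact spec_res_zmod_morphism : zmod_morphism spec_res.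
Proof. by move=> s t; exact: spec_sec_ext. Qed.

Fact spec_res_monoid_morphism : monoid_morphism spec_res.
Proof. by split=> [|s t]; exact: spec_sec_ext. Qed.

HB.instance Definition _ := GRing.isZmodMorphism.Build _ _ spec_res
  spec_res_zmod_morphism.
HB.instance Definition _ := GRing.isMonoidMorphism.Build _ _ spec_res
  spec_res_monoid_morphism.

End Restriction.

Fact spec_sec_irr (U : opens (spec A)) (s : spec_sec U) p (h h' : U p) :
  s p h = s p h'.
Proof. by congr (spec_sec_fun s _); exact: Prop_irrelevance. Qed.

Fact spec_res_id (U : opens (spec A)) (h : U `<=` U) (s : spec_sec U) :
  spec_res h s = s.
Proof.
by apply: spec_sec_ext => p Up /=; exact: spec_sec_irr.
Qed.

Fact spec_res_comp (U V W : opens (spec A)) (hVU : V `<=` U) (hWV : W `<=` V)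
    (hWU : W `<=` U) (s : spec_sec U) :
  spec_res hWV (spec_res hVU s) = spec_res hWU s.
Proof.
by apply: spec_sec_ext => p Up /=; exact: spec_sec_irr.
Qed.

Fact spec_sec_glue (I : Type) (U : I -> opens (spec A)) (V : opens (spec A))
    (hU : forall i, U i `<=` V) (s : forall i, spec_sec (U i)) :
  V `<=` \bigcup_i U i ->
  (forall i j,
    spec_res (@subIsetl _ (U i) (U j) : opensI (U i) (U j) `<=` U i) (s i) =
    spec_res (@subIsetr _ (U i) (U j) : opensI (U i) (U j) `<=` U j) (s j)) ->
  exists! t : spec_sec V, forall i, spec_res (hU i) t = s i.
Proof.
move=> cov comp.
have compE i j p (Uip : U i p) (Ujp : U j p) : s i p Uip = s j p Ujp.
  have e := congr1 (fun t : spec_sec (opensI (U i) (U j)) => t p (conj Uip Ujp))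
    (comp i j).
  by rewrite /= in e; apply: etrans (etrans e _); exact: spec_sec_irr.
have idx p : V p -> {i | U i p}.
  by move=> /cov h; apply: cid; case: h => i _ Uip; exists i.
pose t p (Vp : V p) : localization p := s _ p (projT2 (idx p Vp)).
have tE i p (Uip : U i p) (Vp : V p) : t p Vp = s i p Uip by exact: compE.
have tP : locally_fraction t.
  move=> p Vp; have [i Uip] := idx p Vp.
  have [W [Wp WU [a [f sf]]]] := spec_secP (s i) Uip.
  exists W; split=> [//|q /WU/hU//|]; exists a, f => q Vq Wq.
  by rewrite (tE i q (WU _ Wq)); exact: sf.
exists (SpecSec tP); split=> [i|t' t'E].
  by apply: spec_sec_ext => p Uip /=; exact: tE.
apply: spec_sec_ext => p Vp /=; have [i Uip] := idx p Vp.
rewrite (tE i p Uip) -(t'E i) /=.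
exact: spec_sec_irr.
Qed.

Definition Spec_space : ringed_space := @RingedSpace (spec A)
  (fun U => spec_sec U) (fun U V h => spec_res h)
  spec_res_id spec_res_comp spec_sec_glue.

End Zariski.

(** ** Schemes *)

Record rs_hom (X Y : ringed_space) : Type := RSHom {
  rs_hom_fun :> X -> Y;
  rs_hom_cont : continuous rs_hom_fun;
  rs_sharp : forall V : opens Y,
    {rmorphism sec V -> sec (opens_preim rs_hom_cont V)};
  rs_sharp_res : forall (V W : opens Y) (hWV : W `<=` V)
    (h : opens_preim rs_hom_cont W `<=` opens_preim rs_hom_cont V) (s : sec V),
    res h (rs_sharp V s) = rs_sharp W (res hWV s) }.

Arguments rs_hom_cont {X Y} r.
Arguments rs_sharp {X Y} r V.

(* There is an isomorphism of ringed spaces from Spec A to (U, O_X|U): phi,  *)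
(* seen as a map to X, is a homeomorphism onto U and induces isomorphisms on *)
(* sections over the open subsets of U.                                      *)
Definition is_affine_open (X : ringed_space) (U : opens X) : Prop :=
  exists (A : comPzRingType) (phi : rs_hom (Spec_space A) X),
    [/\ injective phi,
        range phi = U,
        forall W : set (Spec_space A), open W -> open (phi @` W) &
        forall V : opens X, V `<=` U -> bijective (rs_sharp phi V)].

(* The stalks are local rings: this follows from scheme_affine.              *)
Record scheme : Type := Scheme {
  scheme_rs :> ringed_space;
  scheme_affine : forall x : scheme_rs,
    exists2 U : opens scheme_rs, U x & is_affine_open U }.

(* The germ of s at x is a unit of the stalk at x.                           *)
Definition germ_unit (X : ringed_space) (x : X) (U : opens X) (s : sec U) :
    Prop :=
  exists (W : opens X) (hWU : W `<=` U), W x /\ exists t : sec W, res hWU s * t = 1.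

(* The ring maps O_(Y, f x) -> O_(X, x) induced by f on stalks are local.    *)
Definition local_on_stalks (X Y : ringed_space) (f : rs_hom X Y) : Prop :=
  forall (x : X) (V : opens Y) (s : sec V), V (f x) ->
    germ_unit x (rs_sharp f V s) -> germ_unit (f x) s.

Record scheme_hom (X Y : scheme) : Type := SchemeHom {
  scheme_hom_rs :> rs_hom X Y;
  scheme_hom_local : local_on_stalks scheme_hom_rs }.

Section Identity.
Variable X : ringed_space.

Fact id_cont : continuous (@idfun X).
Proof. by move=> x. Qed.

Fact id_sub (V : opens X) : opens_preim id_cont V `<=` V.
Proof. by []. Qed.

(* opens_preim id_cont V and V have the same underlying set, but differ in   *)
(* their openness proofs; restriction along this equality transports between *)
(* them. The same device is used for composition.                            *)
Definition id_sharp (V : opens X) :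
    {rmorphism sec V -> sec (opens_preim id_cont V)} :=
  res (@id_sub V).

Fact id_sharp_res (V W : opens X) (hWV : W `<=` V)
    (h : opens_preim id_cont W `<=` opens_preim id_cont V) (s : sec V) :
  res h (id_sharp V s) = id_sharp W (res hWV s).
Proof.
have hW : opens_preim id_cont W `<=` V by move=> x; exact: hWV.
by rewrite /id_sharp (res_comp _ _ hW) (res_comp _ _ hW).
Qed.

Definition id_rs : rs_hom X X := RSHom id_sharp_res.

Fact id_local : local_on_stalks id_rs.
Proof.
move=> x V s Vx [W [hW [Wx [t st]]]].
exists W, (hW : W `<=` V); split=> //; exists t.
by rewrite -st /= /id_sharp (res_comp _ _ (hW : W `<=` V)).
Qed.

End Identity.

Definition scheme_id (X : scheme) : scheme_hom X X := SchemeHom (@id_local X).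

Section Composition.
Variables (X Y Z : ringed_space) (g : rs_hom Y Z) (f : rs_hom X Y).

Fact comp_cont : continuous (g \o f).
Proof.
by move=> x; apply: continuous_comp; [exact: rs_hom_cont|exact: rs_hom_cont].
Qed.

Fact comp_sub (V : opens Z) : opens_preim comp_cont V `<=`
    opens_preim (rs_hom_cont f) (opens_preim (rs_hom_cont g) V).
Proof. by []. Qed.

Definition comp_sharp (V : opens Z) :
    {rmorphism sec V -> sec (opens_preim comp_cont V)} :=
  res (@comp_sub V) \o (rs_sharp f _ \o rs_sharp g V).

Lemma comp_sharpE (V : opens Z) (s : sec V) :
  comp_sharp V s = res (@comp_sub V) (rs_sharp f _ (rs_sharp g V s)).
Proof. by []. Qed.

Fact comp_sharp_res (V W : opens Z) (hWV : W `<=` V)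
    (h : opens_preim comp_cont W `<=` opens_preim comp_cont V) (s : sec V) :
  res h (comp_sharp V s) = comp_sharp W (res hWV s).
Proof.
rewrite !comp_sharpE.
have hg : opens_preim (rs_hom_cont g) W `<=` opens_preim (rs_hom_cont g) V.
  by move=> y; exact: hWV.
have hf : opens_preim (rs_hom_cont f) (opens_preim (rs_hom_cont g) W) `<=`
          opens_preim (rs_hom_cont f) (opens_preim (rs_hom_cont g) V).
  by move=> x; exact: hWV.
have hc : opens_preim comp_cont W `<=`
          opens_preim (rs_hom_cont f) (opens_preim (rs_hom_cont g) V).
  by move=> x; exact: hWV.
by rewrite -(rs_sharp_res hWV hg) -(rs_sharp_res hg hf) !(res_comp _ _ hc).
Qed.

Definition comp_rs : rs_hom X Z := RSHom comp_sharp_res.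

Fact comp_local :
  local_on_stalks g -> local_on_stalks f -> local_on_stalks comp_rs.
Proof.
move=> gl fl x V s Vx [W [hW [Wx [t st]]]].
apply: (gl (f x) V s) => //.
apply: (fl x _ (rs_sharp g V s)) => //.
have hW' : W `<=` opens_preim (rs_hom_cont f) (opens_preim (rs_hom_cont g) V).
  by move=> y; exact: hW.
exists W, hW'; split=> //; exists t; rewrite -st; congr (_ * _).
by rewrite [RHS](_ : _ = res hW (comp_sharp V s)) // comp_sharpE (res_comp _ _ hW').
Qed.

End Composition.

Definition scheme_comp (X Y Z : scheme) (g : scheme_hom Y Z)
    (f : scheme_hom X Y) : scheme_hom X Z :=
  SchemeHom (comp_local (@scheme_hom_local _ _ g) (@scheme_hom_local _ _ f)).

(** ** Morphisms of finite type *)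

(* B is generated as an A-algebra by a finite set.                           *)
Definition finite_type_ring_hom (A B : comPzRingType)
    (f : {rmorphism A -> B}) : Prop :=
  exists bs : seq B, forall S : {pred B}, subring_closed S ->
    (forall a, f a \in S) -> {in bs, forall b, b \in S} -> forall b, b \in S.

Definition sharp_res (X Y : ringed_space) (f : rs_hom X Y) (V : opens Y)
    (U : opens X) (h : U `<=` opens_preim (rs_hom_cont f) V) :
    {rmorphism sec V -> sec U} :=
  res h \o rs_sharp f V.

Definition locally_of_finite_type (X Y : scheme) (f : scheme_hom X Y) : Prop :=
  forall x : X, exists (U : opens X) (V : opens Y)
      (h : U `<=` opens_preim (rs_hom_cont f) V),
    [/\ U x, is_affine_open U, is_affine_open V &
        finite_type_ring_hom (sharp_res h)].

(* compact does not include the Hausdorff condition.                         *)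
Definition quasi_compact (X Y : scheme) (f : scheme_hom X Y) : Prop :=
  forall V : set Y, open V -> compact V -> compact (f @^-1` V).

Definition of_finite_type (X Y : scheme) (f : scheme_hom X Y) : Prop :=
  locally_of_finite_type f /\ quasi_compact f.

(** ** Group actions *)

Record scheme_action (G : groupType) (X : scheme) : Type := SchemeAction {
  act :> G -> scheme_hom X X;
  act1 : act 1%g = scheme_id X;
  actM : forall g h : G, act (g * h)%g = scheme_comp (act g) (act h) }.

Definition equivariant (G : groupType) (X Y : scheme)
    (aX : scheme_action G X) (aY : scheme_action G Y) (f : scheme_hom X Y) :
    Prop :=
  forall g : G, scheme_comp f (aX g) = scheme_comp (aY g) f.

Definition stable (G T : Type) (a : G -> T -> T) (Z : set T) : Prop :=
  forall g, a g @` Z `<=` Z.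

Definition G_noetherian (G : Type) (T : topologicalType) (a : G -> T -> T) :
    Prop :=
  forall Z : nat -> set T,
    (forall n, closed (Z n)) -> (forall n, stable a (Z n)) ->
    (forall n, Z n.+1 `<=` Z n) ->
    exists N, forall n, (N <= n)%N -> Z n = Z N.

Definition topologically_G_noetherian (G : groupType) (X : scheme)
    (a : scheme_action G X) : Prop :=
  G_noetherian (fun g : G => a g : X -> X).

(* Main.v *)
(** By noetherian induction on the base, it suffices to show that a descending
    chain of closed subsets of X stabilizes over a nonempty open subset of a
    given nonempty closed T of S: if the chain itself is G-stable, then it
    stabilizes over all the translates of that open subset, and the complement
    of these in T is a smaller G-stable closed subset.

    The generic stabilization does not involve G. On a pair of affine charts
    Spec B -> Spec A with B generated by b_1, ..., b_r over A, consider, for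
    each principal open D(a) meeting T and each n, the set of monomials in the
    b_i which are, for the lexicographic order, leading monomials of elements of
    the n-th ideal I_n with leading coefficient invertible on D(a). It is closed
    under multiplication by monomials and grows with n and as D(a) shrinks, so
    by Dickson's lemma it is maximal for some (a, N). An element of I_n, n >= N,
    is then reduced to 0 modulo I_N over D(a): were a remainder to have a leading
    coefficient c not vanishing identically on T inside D(a), its leading
    monomial would appear over D(a c), contradicting maximality.

    A compact set of the form f^-1(V) is covered by finitely many such charts,
    over which the open subset of S is shrunk successively; a chart whose image
    misses T inside the current open subset imposes no condition. *)
Require Import Defs.
From mathcomp Require Import all_boot all_algebra all_classical topology.
From mathcomp Require Import zify ring.

Set Implicit Arguments.
Unset Strict Implicit.
Unset Printing Implicit Defensive.

Import GRing.Theory.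

Local Open Scope classical_set_scope.
Local Open Scope ring_scope.

(** * Exponents and Dickson's lemma *)

Fixpoint expo (r : nat) : Type :=
  if r is r'.+1 then (nat * expo r')%type else unit.

Fixpoint expo0 (r : nat) : expo r :=
  if r is r'.+1 then (0%N, expo0 r') else tt.

Fixpoint expoD (r : nat) : expo r -> expo r -> expo r :=
  if r is r'.+1 then fun d e => ((d.1 + e.1)%N, expoD d.2 e.2)
  else fun _ _ => tt.

Fixpoint lexlt (r : nat) : expo r -> expo r -> Prop :=
  if r is r'.+1 then
    fun d e => (d.1 < e.1)%N \/ d.1 = e.1 /\ lexlt d.2 e.2
  else fun _ _ => False.

Lemma lexlt_trans r (c d e : expo r) : lexlt c d -> lexlt d e -> lexlt c e.
Proof.
elim: r c d e => //= r IH [i c] [j d] [k e] /=.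
case=> [ij|[-> cd]]; case=> [jk|[<- de]]; [left; lia|by left..|].
by right; split=> //; exact: IH de.
Qed.

Lemma lexlt_total r (d e : expo r) : [\/ lexlt d e, d = e | lexlt e d].
Proof.
elim: r d e => [[] []|r IH [i d] [j e]] /=; first exact: Or32.
have [ij|ji|->] := ltngtP i j; [by apply: Or31; left|by apply: Or33; left|].
case: (IH d e) => [de|->|ed]; last by apply: Or33; right.
  by apply: Or31; right.
exact: Or32.
Qed.

Lemma lexlt_expoD r (c d e : expo r) :
  lexlt d e -> lexlt (expoD c d) (expoD c e).
Proof.
elim: r c d e => //= r IH [i c] [j d] [k e] /=.
by case=> [jk|[-> de]]; [left; lia|right; split=> //; exact: IH].
Qed.

Lemma lexlt_wf r : well_founded (@lexlt r).
Proof.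
elim: r => [|r IH] /=; first by move=> e; split.
suff H k : forall e, Acc (@lexlt r.+1) (k, e) by case.
elim/ltn_ind: k => k IHk e.
elim: (IH e) => {}e _ IHe; split=> -[j d] /= [jk|[-> de]]; first exact: IHk.
exact: IHe.
Qed.

(** The subsequence visits indices at which [u] attains its minimum over the remaining tail. *)
Lemma nat_nondecreasing_subseq (u : nat -> nat) : exists s : nat -> nat,
  forall i j, (i < j)%N -> (s i < s j)%N /\ (u (s i) <= u (s j))%N.
Proof.
have argmin k : {m | (k <= m)%N & forall j, (k <= j)%N -> (u m <= u j)%N}.
  apply: cid2; have ex : exists v, `[< exists2 m, (k <= m)%N & u m = v >].
    by exists (u k); apply/asboolP; exists k.
  have [_ /asboolP[m km <-] mP] := ex_minnP ex.
  by exists m => // j kj; apply: mP; apply/asboolP; exists j.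
pose m k := s2val (argmin k).
have m_ge k : (k <= m k)%N by exact: (s2valP (argmin k)).
have m_min k j : (k <= j)%N -> (u (m k) <= u j)%N.
  exact: (s2valP' (argmin k)).
pose s := fix s i := if i is i'.+1 then m (s i').+1 else m 0%N.
have sS i : (s i < s i.+1)%N by exact: m_ge.
have s_lt i j : (i < j)%N -> (s i < s j)%N.
  elim: j => // j IH; rewrite ltnS leq_eqVlt => /predU1P[->//|/IH].
  by have := sS j; lia.
exists s => i j ij; split; first exact: s_lt.
by case: i ij => [|i] ij /=; apply: m_min => //; apply: s_lt; lia.
Qed.

(* Dickson's lemma, in the form of an infinite nondecreasing subsequence,
   which is what the induction on the number of variables needs. *)
Lemma dickson_subseq r (u : nat -> expo r) : exists s : nat -> nat,
  forall i j, (i < j)%N ->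
    (s i < s j)%N /\ exists d, u (s j) = expoD d (u (s i)).
Proof.
elim: r u => [|r IH] u.
  by exists id => i j ij; split=> //; exists tt; case: (u _).
have [s sP] := nat_nondecreasing_subseq (fun i => (u i).1).
have [t tP] := IH (fun i => (u (s i)).2).
exists (s \o t) => i j /tP[tij [d dP]]; have [sij uij] := sP _ _ tij.
split=> //; exists (((u (s (t j))).1 - (u (s (t i))).1)%N, d) => /=.
by rewrite -dP subnK //; case: (u _).
Qed.

(** * Generic stabilization of ideals in algebras of finite type *)

Section Span.
Variables (A B : comPzRingType) (phi : {rmorphism A -> B}) (bs : seq B).
Local Notation exps := (expo (size bs)).

Fixpoint monomial (cs : seq B) : expo (size cs) -> B :=
  if cs is c :: cs' then fun e => c ^+ e.1 * monomial e.2 else fun=> 1.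

Lemma monomialD (cs : seq B) (d e : expo (size cs)) :
  monomial (expoD d e) = monomial d * monomial e.
Proof.
elim: cs d e => [|c cs IH] d e /=; first by rewrite mulr1.
by rewrite IH exprD; ring.
Qed.

Lemma monomial0 (cs : seq B) : monomial (expo0 (size cs)) = 1.
Proof. by elim: cs => //= c cs ->; rewrite mulr1. Qed.

Lemma mem_monomial (cs : seq B) b :
  b \in cs -> exists e, b = monomial (cs := cs) e.
Proof.
elim: cs => //= c cs IH; rewrite inE => /predU1P[->|/IH[e ->]].
  by exists (1%N, expo0 _); rewrite /= monomial0 mulr1.
by exists (0%N, e); rewrite /= mul1r.
Qed.

(** The monomials may be linearly dependent over [A], so a leading term belongs to an expression,
    not to an element. *)
Inductive span (P : exps -> Prop) : B -> Prop :=
| span0 : span P 0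
| span_cons c e b : P e -> span P b -> span P (phi c * monomial e + b).

Lemma spanS (P Q : exps -> Prop) b :
  (forall e, P e -> Q e) -> span P b -> span Q b.
Proof. by move=> PQ; elim=> [|c e ? /PQ Qe _]; [left|exact: span_cons]. Qed.

Lemma span_term (P : exps -> Prop) c e : P e -> span P (phi c * monomial e).
Proof. by move=> Pe; rewrite -[X in span _ X]addr0; right=> //; left. Qed.

Lemma spanD (P : exps -> Prop) x y : span P x -> span P y -> span P (x + y).
Proof.
by move=> xP yP; elim: xP => [|c e b Pe _ IH]; rewrite ?add0r // -addrA; right.
Qed.

Lemma spanZ (P : exps -> Prop) a x : span P x -> span P (phi a * x).
Proof.
elim=> [|c e b Pe _ IH]; first by rewrite mulr0; left.
by rewrite mulrDr mulrA -rmorphM; right.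
Qed.

Lemma spanN (P : exps -> Prop) x : span P x -> span P (- x).
Proof. by move=> /(spanZ (- 1)); rewrite rmorphN1 mulN1r. Qed.

Lemma span_monomialM (P Q : exps -> Prop) d x :
  (forall e, P e -> Q (expoD d e)) -> span P x -> span Q (monomial d * x).
Proof.
move=> PQ; elim=> [|c e b /PQ Qe _ IH]; first by rewrite mulr0; left.
have -> : monomial d * (phi c * monomial e + b) =
    phi c * monomial (expoD d e) + monomial d * b by rewrite monomialD; ring.
by right.
Qed.

Lemma spanM x y : span setT x -> span setT y -> span setT (x * y).
Proof.
move=> xP yP; elim: xP => [|c e b _ _ IH]; first by rewrite mul0r; left.
rewrite mulrDl -mulrA; apply: spanD => //; apply: spanZ.
exact: span_monomialM yP.
Qed.

(** A term added to an expression is compared with its leading term; equal exponents merge. The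
    resulting [phi c] may be zero, which does not hurt a descent on exponents. *)
Lemma span_leading (P : exps -> Prop) x : span P x ->
  x = 0 \/ exists c e g,
    [/\ P e, span (fun d => lexlt d e) g & x = phi c * monomial e + g].
Proof.
elim=> [|c e b Pe _ [->|[c' [e' [g [Pe' gP ->]]]]]]; first by left.
  by right; exists c, e, 0; split=> //; left.
right; case: (lexlt_total e e') => [ee'|ee'|e'e].
- exists c', e', (phi c * monomial e + g); split=> //; last by ring.
  exact: span_cons.
- by exists (c + c'), e, g; split; rewrite ?rmorphD ee' //; ring.
- exists c, e, (phi c' * monomial e' + g); split=> //.
  by apply: span_cons => //; apply: spanS gP => d /lexlt_trans; apply.
Qed.

End Span.

Lemma finite_type_span (A B : comPzRingType) (phi : {rmorphism A -> B}) :
  finite_type_ring_hom phi ->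
  exists bs : seq B, forall b, span phi (bs := bs) setT b.
Proof.
move=> [bs gen]; exists bs => b.
have spanE x : (x \in [pred x | `[< span phi (bs := bs) setT x >]]) =
  `[< span phi (bs := bs) setT x >] by [].
apply/asboolP; rewrite -spanE; apply: gen.
- split=> [|x y|x y]; rewrite !spanE.
  + apply/asboolP; rewrite -[1]mulr1 -{1}(rmorph1 phi) -(monomial0 bs).
    exact: span_term.
  + by move=> /asboolP xP /asboolP yP; apply/asboolP/spanD/spanN.
  + by move=> /asboolP xP /asboolP yP; apply/asboolP/spanM.
- move=> a; rewrite spanE; apply/asboolP.
  by rewrite -[phi a]mulr1 -(monomial0 bs); exact: span_term.
- move=> x /mem_monomial[e ->]; rewrite spanE; apply/asboolP.
  by rewrite -[monomial e]mul1r -(rmorph1 phi); exact: span_term.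
Qed.

(* Read J as the ideal of a closed subset of Spec A and I n as the ideal of the
   n-th member of a descending chain in Spec B lying over it: the chain
   stabilizes over a nonempty open subset D(a0 * c) of D(a0). The ring A/J need
   be neither noetherian nor a domain, since the open subset may depend on the
   chain. *)
Section GenericStabilization.
Variables (A B : comPzRingType) (phi : {rmorphism A -> B}).
Variables (J : set A) (I : nat -> set B).
Hypothesis phi_ft : finite_type_ring_hom phi.
Hypothesis phiJ : forall n a, J a -> I n (phi a).
Hypothesis I0 : forall n, I n 0.
Hypothesis ID : forall n x y, I n x -> I n y -> I n (x + y).
Hypothesis IM : forall n b x, I n x -> I n (b * x).
Hypothesis IS : forall m n, (m <= n)%N -> I m `<=` I n.

Section Leading.
Variable bs : seq B.
Local Notation exps := (expo (size bs)).

(* The leading monomials of elements of I n whose leading coefficient becomes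
   invertible over D(a). *)
Definition leading (a : A) (n : nat) (e : exps) : Prop :=
  exists k g, span phi (fun d => lexlt d e) g /\
    I n (phi a ^+ k * monomial e + g).

Lemma leading_expoD a n d e : leading a n e -> leading a n (expoD d e).
Proof.
move=> [k [g [gP Ig]]]; exists k, (monomial d * g); split.
  by apply: span_monomialM gP => c; exact: lexlt_expoD.
have := IM (monomial d) Ig; congr (I n _); rewrite monomialD; ring.
Qed.

Lemma leadingM a c m n e : (m <= n)%N -> leading a m e -> leading (a * c) n e.
Proof.
move=> mn [k [g [gP /(IS mn) Ig]]]; exists k, (phi (c ^+ k) * g).
split; first exact: spanZ.
have := IM (phi (c ^+ k)) Ig; congr (I n _); rewrite !rmorphXn rmorphM exprMn.
by rewrite mulrDr; congr (_ + _); rewrite mulrA; congr (_ * _); exact: mulrC.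
Qed.

(** Otherwise each stage [(c, n)] has a successor with a new leading exponent, and Dickson's lemma
    applies to the sequence of these. *)
Lemma exists_maximal_leading a0 : ~ J a0 -> exists c0 n0, ~ J (a0 * c0) /\
  forall c n e, (n0 <= n)%N -> ~ J (a0 * c0 * c) ->
    leading (a0 * c0 * c) n e -> leading (a0 * c0) n0 e.
Proof.
move=> Ja0; apply: contrapT => nomax.
pose T := {q : A * nat | ~ J (a0 * q.1)}.
have next (q : T) : {q' : T & {e : exps |
    [/\ exists2 c, (sval q').1 = (sval q).1 * c & ((sval q).2 <= (sval q').2)%N,
        leading (a0 * (sval q').1) (sval q').2 e &
        ~ leading (a0 * (sval q).1) (sval q).2 e]}}.
  suff H : exists (q' : T) (e : exps),
      [/\ exists2 c, (sval q').1 = (sval q).1 * c & ((sval q).2 <= (sval q').2)%N, leading (a0 * (sval q').1) (sval q').2 e &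
      ~ leading (a0 * (sval q).1) (sval q).2 e].
    by have [q' {}H] := cid H; have [e eP] := cid H; exists q', e.
  case: q => -[c0 n0] /= Jc0; apply: contrapT => H; apply: nomax.
  exists c0, n0; split=> // c n e n0n Jc lead; apply: contrapT => nlead.
  apply: H; have Jc' : ~ J (a0 * (c0 * c, n).1) by rewrite /= mulrA.
  exists (exist (fun q : A * nat => ~ J (a0 * q.1)) (c0 * c, n) Jc'), e => /=.
  by split; [exists c|rewrite mulrA|].
have Ja1 : ~ J (a0 * (1, 0%N).1) by rewrite /= mulr1.
pose q := fix q i : T := if i is i'.+1 then projT1 (next (q i'))
  else exist (fun q : A * nat => ~ J (a0 * q.1)) (1, 0%N) Ja1.
pose u i := sval (projT2 (next (q i))).
have qP i : [/\ exists2 c, (sval (q i.+1)).1 = (sval (q i)).1 * c &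
        ((sval (q i)).2 <= (sval (q i.+1)).2)%N,
        leading (a0 * (sval (q i.+1)).1) (sval (q i.+1)).2 (u i) &
        ~ leading (a0 * (sval (q i)).1) (sval (q i)).2 (u i)].
  exact: (svalP (projT2 (next (q i)))).
have q_mono i j : (i <= j)%N -> exists2 c,
    (sval (q j)).1 = (sval (q i)).1 * c & ((sval (q i)).2 <= (sval (q j)).2)%N.
  elim: j => [|j IH].
    by rewrite leqn0 => /eqP->; exists 1; rewrite ?mulr1.
  rewrite leq_eqVlt => /predU1P[->|/IH[c e le]].
    by exists 1; rewrite ?mulr1.
  have [[d de dle] _ _] := qP j; exists (c * d); last exact: leq_trans dle.
  by rewrite de e mulrA.
have [s sP] := dickson_subseq u; have [s01 [d dP]] := sP 0%N 1%N isT.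
(* [u (s 0)] is leading from stage [s 0 + 1 <= s 1] on, so its multiple [u (s 1)] is not new at
   stage [s 1]. *)
have [_ lead _] := qP (s 0%N); have [_ _] := qP (s 1%N); apply.
rewrite dP; apply: leading_expoD; have [c -> le] := q_mono _ _ s01.
by rewrite mulrA; exact: leadingM lead.
Qed.

End Leading.

Lemma generic_stabilization a0 : ~ J a0 -> exists c N, ~ J (a0 * c) /\
  forall n b, (N <= n)%N -> I n b -> exists k, I N (phi (a0 * c) ^+ k * b).
Proof.
move=> Ja0; have [bs gen] := finite_type_span phi_ft.
have [c0 [N [Jc0 maxl]]] := exists_maximal_leading bs Ja0.
set a := a0 * c0 in Jc0 maxl *.
exists c0, N; split=> // n b Nn.
have reduce (e : expo (size bs)) c g : span phi (fun d => lexlt d e) g ->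
    I n (phi c * monomial e + g) ->
    exists k, I N (phi a ^+ k * (phi c * monomial e + g)).
  elim: (@lexlt_wf (size bs) e) c g => {}e _ IH c g gP Ig.
  (* This gives an element of [I N] with the same leading term up to a power of [phi a]. *)
  have [k [g' [g'P Ig']]] : exists k g', span phi (fun d => lexlt d e) g' /\
      I N (phi a ^+ k * (phi c * monomial e) + g').
    have [[k [g' [g'P Ig']]]|nlead] := pselect (leading a N e).
      exists k, (phi c * g'); split; first exact: spanZ.
      by have := IM (phi c) Ig'; congr (I N _); ring.
    (* If [a * c] were outside [J], then [e] would be leading for [a * c] at level [n], hence by
       maximality for [a] at level [N]. *)
    have [/(phiJ N) Jac|nJac] := pselect (J (a * c)); last first.
      case: nlead; apply: (maxl c n) => //; exists 1%N, (phi a * g).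
      split; first exact: spanZ.
      by have := IM (phi a) Ig; congr (I n _); rewrite rmorphM; ring.
    exists 1%N, 0; split; first by left.
    by have := IM (monomial e) Jac; congr (I N _); rewrite rmorphM; ring.
  (* The leading terms cancel: [h] stays in [I n] and involves only exponents below [e]. *)
  pose h := phi (a ^+ k) * g - g'.
  have hE : phi a ^+ k * (phi c * monomial e + g) =
      h + (phi a ^+ k * (phi c * monomial e) + g').
    by rewrite /h rmorphXn; ring.
  have Ih : I n h.
    rewrite -[h](addrK (phi a ^+ k * (phi c * monomial e) + g')) -hE -mulN1r.
    by apply: ID; apply: IM => //; exact: IS Ig'.
  have [k' Ik'] : exists k', I N (phi a ^+ k' * h).
    have hP : span phi (fun d => lexlt d e) h.
      by apply: spanD; [exact: spanZ|exact: spanN].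
    have [->|[c' [d [g'' [de g''P hE']]]]] := span_leading hP.
      by exists 0%N; rewrite mulr0.
    by rewrite hE' in Ih *; exact: IH Ih.
  exists (k' + k)%N; rewrite exprD -mulrA hE mulrDr.
  by apply: ID => //; exact: IM.
have [->|[c [e [g [_ gP ->]]]]] := span_leading (gen b); last exact: reduce.
by exists 0%N; rewrite mulr0.
Qed.

End GenericStabilization.

(** * Units in the stalks and affine opens *)

Section LocalRing.
Variables (A : comPzRingType) (p : spec A).

Definition loc_unit (z : localization p) : Prop :=
  exists a f (pf : ~ p f), z = mkloc a pf /\ ~ p a.

Lemma spec0 : p 0.
Proof. by case: (specP p). Qed.

Lemma specD x y : p x -> p y -> p (x + y).
Proof. by case: (specP p) => _ pD _ _ _; exact: pD. Qed.

Lemma specMl a x : p x -> p (a * x).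
Proof. by case: (specP p) => _ _ pM _ _; exact: pM. Qed.

Lemma specMr a x : p x -> p (x * a).
Proof. by rewrite mulrC; exact: specMl. Qed.

Lemma loc_unit_mkloc a f (pf : ~ p f) : loc_unit (mkloc a pf) <-> ~ p a.
Proof.
split=> [[b [g [pg [/mklocE[t pt e] pb]]]] pa|pa]; last by exists a, f, pf.
by apply: (specM pt (specM pb pf)); rewrite -e; exact/specMl/specMr.
Qed.

Lemma mulloc_mkloc a f (pf : ~ p f) b g (pg : ~ p g) :
  mkloc a pf * mkloc b pg = mkloc (a * b) (specM pf pg).
Proof. exact: mul_mkloc. Qed.

Lemma addloc_mkloc a f (pf : ~ p f) b g (pg : ~ p g) :
  mkloc a pf + mkloc b pg = mkloc (a * g + b * f) (specM pf pg).
Proof. exact: add_mkloc. Qed.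

Lemma loc_unitP (z z' : localization p) : z * z' = 1 -> loc_unit z.
Proof.
have [a [f [pf ->]]] := mklocP z; have [b [g [pg ->]]] := mklocP z'.
rewrite mulloc_mkloc -[1]/(mkloc 1 (@spec1 _ p)) => /mklocE[t pt e].
apply/loc_unit_mkloc => pa; apply: (specM pt (specM pf pg)).
by rewrite -[f * g]mul1r -e; apply: specMl; do 2![apply: specMr].
Qed.

(** The localization is a local ring: if both numerators lie in [p], so does that of the sum. *)
Lemma loc_unitD (z z' : localization p) :
  loc_unit (z + z') -> loc_unit z \/ loc_unit z'.
Proof.
have [a [f [pf ->]]] := mklocP z; have [b [g [pg ->]]] := mklocP z'.
rewrite addloc_mkloc !loc_unit_mkloc => pab; apply: contrapT => /not_orP[].
by move=> /contrapT pa /contrapT pb; apply: pab; apply: specD; exact: specMr.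
Qed.

Lemma loc_unit0 : ~ loc_unit (0 : localization p).
Proof.
by rewrite -[0]/(mkloc 0 (@spec1 _ p)) => /loc_unit_mkloc; apply; exact: spec0.
Qed.

End LocalRing.

(** * Nonvanishing loci of sections *)

Section GermUnit.
Variable X : ringed_space.

Lemma germ_unit_open (U : opens X) (s : sec U) : open [set x | germ_unit x s].
Proof.
rewrite openE => x /= [W [hW [Wx [t st]]]].
apply: filterS (open_nbhs_nbhs (conj (opensP W) Wx)) => y Wy.
by exists W, hW; split=> //; exists t.
Qed.

Lemma germ_unit_sub (x : X) (U : opens X) (s : sec U) : germ_unit x s -> U x.
Proof. by move=> [W [hW [/hW]]]. Qed.

Lemma germ_unitMr (x : X) (U : opens X) (s t : sec U) :
  germ_unit x (s * t) -> germ_unit x t.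
Proof.
move=> [W [hW [Wx [u e]]]]; exists W, hW; split=> //; exists (res hW s * u).
by rewrite -e rmorphM mulrCA mulrA.
Qed.

Lemma germ_unitM (x : X) (U : opens X) (s t : sec U) :
  germ_unit x s -> germ_unit x t -> germ_unit x (s * t).
Proof.
move=> [V [hV [Vx [u su]]]] [W [hW [Wx [v tv]]]].
have hVW : opensI V W `<=` V by exact: subIsetl.
have hWV : opensI V W `<=` W by exact: subIsetr.
have hVWU : opensI V W `<=` U by move=> y /hVW /hV.
exists (opensI V W), hVWU; split=> //; exists (res hVW u * res hWV v).
rewrite rmorphM mulrACA -(res_comp hV hVW hVWU) -(res_comp hW hWV hVWU).
by rewrite -!rmorphM su tv !rmorph1 mulr1.
Qed.

Lemma germ_unit1 (x : X) (U : opens X) : U x -> germ_unit x (1 : sec U).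
Proof.
move=> Ux; exists U, (@subset_refl _ U); split=> //.
by exists 1; rewrite rmorph1 mulr1.
Qed.

Lemma germ_unitX (x : X) (U : opens X) (s : sec U) k :
  germ_unit x s -> germ_unit x (s ^+ k).
Proof.
move=> su; elim: k => [|k IH]; last by rewrite exprS; exact: germ_unitM.
by rewrite expr0; exact/germ_unit1/(germ_unit_sub su).
Qed.

Lemma germ_unit_res (x : X) (U V : opens X) (h : V `<=` U) (s : sec U) :
  V x -> germ_unit x (res h s) <-> germ_unit x s.
Proof.
move=> Vx; split=> [[W [hW [Wx [t e]]]]|[W [hW [Wx [t e]]]]].
  have hWU : W `<=` U by move=> y /hW /h.
  by exists W, hWU; split=> //; exists t; rewrite -(res_comp h hW).
have hV : opensI V W `<=` V by exact: subIsetl.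
have hW' : opensI V W `<=` W by exact: subIsetr.
have hU : opensI V W `<=` U by move=> y /hV /h.
exists (opensI V W), hV; split=> //; exists (res hW' t).
by rewrite (res_comp h hV hU) -(res_comp hW hW' hU) -rmorphM e rmorph1.
Qed.

End GermUnit.

Lemma germ_unit_sharp (X Y : ringed_space) (f : rs_hom X Y) (x : X)
    (V : opens Y) (s : sec V) :
  germ_unit (f x) s -> germ_unit x (rs_sharp f V s).
Proof.
move=> [W [hW [Wx [t e]]]].
have hf : opens_preim (rs_hom_cont f) W `<=` opens_preim (rs_hom_cont f) V.
  by move=> y; exact: hW.
exists (opens_preim (rs_hom_cont f) W), hf; split=> //.
by exists (rs_sharp f W t); rewrite (rs_sharp_res hW hf) -rmorphM e rmorph1.
Qed.

(** The direction from left to right is the locality of [f] on stalks. *)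
Lemma germ_unit_sharp_res (X Y : scheme) (f : scheme_hom X Y) (x : X)
    (U : opens X) (V : opens Y) (h : U `<=` opens_preim (rs_hom_cont f) V)
    (s : sec V) :
  U x -> germ_unit x (sharp_res h s) <-> germ_unit (f x) s.
Proof.
move=> Ux; rewrite (germ_unit_res h) //; split; last exact: germ_unit_sharp.
by apply: scheme_hom_local; exact: (h x).
Qed.

(** An ultrafilter [F] converges to the ideal of those [a] that lie in [F]-almost all primes; this
    ideal is prime because [F] is an ultrafilter. *)
Lemma compact_spec (A : comPzRingType) : compact [set: spec A].
Proof.
rewrite compact_ultra => F FU _.
have FP : prime_ideal [set a | F [set q : spec A | q a]].
  split=> /=.
  - by apply: filterS filterT => q _; exact: spec0.
  - by move=> x y Fx Fy; apply: filterS2 Fx Fy => q; exact: specD.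
  - by move=> a x; apply: filterS => q; exact: specMl.
  - by move=> /filter_ex[q /spec1].
  - move=> x y Fxy.
    have [|Fx] := in_ultra_setVsetC [set q : spec A | q x] FU; first by left.
    right; apply: filterS2 Fxy Fx => q qxy nqx.
    by have [_ _ _ _ /(_ _ _ qxy)[]] := specP q.
exists (Spec FP); split=> // D; rewrite nbhsE => -[U [Uo UP] UD].
apply: filterS UD _; move: Uo UP; rewrite open_specE => -[E ->] [/= a Ea Fa].
have [//|] := in_ultra_setVsetC [set q : spec A | q a] FU.
by apply: filterS => q nqa; exists a.
Qed.

(** * Affine charts and their principal open subsets *)

Section AffineOpen.
Variables (X : ringed_space) (U : opens X) (A : comPzRingType).
Variable phi : rs_hom (Spec_space A) X.
Hypothesis phi_inj : injective phi.
Hypothesis phi_range : range phi = U.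
Hypothesis phi_open : forall W : set (Spec_space A), open W -> open (phi @` W).
Hypothesis phi_sharp :
  forall V : opens X, V `<=` U -> bijective (rs_sharp phi V).

Let phiU p : opens_preim (rs_hom_cont phi) U p.
Proof. by rewrite /= -phi_range; exists p. Qed.

Let value (s : sec U) (p : spec A) : localization p :=
  (rs_sharp phi U s : spec_sec _) p (phiU p).

(** If the value is [a / f] near [p] with [a] outside [p], then [f / a] is an inverse on a
    neighbourhood, and bijectivity of [rs_sharp] carries it to [X]. *)
Lemma germ_unit_value s p : germ_unit (phi p) s <-> loc_unit (value s p).
Proof.
split=> [[W [hW [Wp [t e]]]]|].
  have hphi : opens_preim (rs_hom_cont phi) W `<=`
      opens_preim (rs_hom_cont phi) U by move=> q; exact: hW.
  have := congr1 (fun u => (rs_sharp phi W u : spec_sec _) p Wp) e.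
  rewrite rmorphM rmorph1 /= -(rs_sharp_res hW hphi) /= => e'.
  apply: (@loc_unitP _ _ _ ((rs_sharp phi W t : spec_sec _) p Wp)).
  by rewrite -[RHS]e'; congr (_ * _); exact: spec_sec_irr.
have [V [Vp VU [a [f sf]]]] :=
  spec_secP (rs_sharp phi U s : spec_sec _) (phiU p).
rewrite /value; have [pf ->] := sf p (phiU p) Vp; move=> /loc_unit_mkloc pa.
have Do : open [set q : spec A | V q /\ ~ q a].
  apply: (@openI (spec A) V [set q | ~ q a]); first exact: opensP.
  rewrite open_specE; exists [set a].
  by rewrite eqEsubset; split=> q /=; [exists a|move=> [_ -> ]].
pose W : opens X := Opens (phi_open Do).
have WD q : opens_preim (rs_hom_cont phi) W q -> V q /\ ~ q a.
  by move=> [q' qD /phi_inj <-].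
have WU : W `<=` U by move=> _ [q _ <-]; exact: phiU.
pose t q (Wq : opens_preim (rs_hom_cont phi) W q) : localization q :=
  mkloc f (WD q Wq).2.
have tP : locally_fraction t.
  move=> q Wq; exists (opens_preim (rs_hom_cont phi) W); split=> //.
  by exists f, a => r Wr _; exists (WD r Wr).2.
have [g _ sharpK] := phi_sharp WU; have sharp_inj := bij_inj (phi_sharp WU).
have hphi : opens_preim (rs_hom_cont phi) W `<=`
    opens_preim (rs_hom_cont phi) U by move=> q; exact: WU.
exists W, WU; split; first by exists p.
exists (g (SpecSec tP)); apply: sharp_inj.
rewrite rmorphM rmorph1 sharpK -(rs_sharp_res WU hphi).
apply: spec_sec_ext => q Wq /=.
have [qf sq] := sf q (hphi _ Wq) (WD q Wq).1.
transitivity (mkloc a qf * mkloc f (WD q Wq).2); first by congr (_ * _).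
by rewrite mulloc_mkloc; apply: eq_mkloc; ring.
Qed.

Lemma germ_unitD_subproof x (s t : sec U) :
  U x -> germ_unit x (s + t) -> germ_unit x s \/ germ_unit x t.
Proof.
rewrite -[in U x]phi_range => -[p _ <-].
rewrite !germ_unit_value => st; apply: loc_unitD; move: st.
by rewrite /value rmorphD.
Qed.

Lemma germ_unit0_subproof x : U x -> ~ germ_unit x (0 : sec U).
Proof.
rewrite -[in U x]phi_range => -[p _ <-].
by rewrite germ_unit_value /value rmorph0 => /loc_unit0.
Qed.

(** A Zariski neighbourhood of [p] contains the nonvanishing locus of some [a] outside [p]; the
    constant section [a] comes from a section over [U]. *)
Lemma germ_unit_basis_subproof x (W : set X) : open W -> U x -> W x ->
  exists2 s : sec U, germ_unit x s & forall y, germ_unit y s -> W y.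
Proof.
move=> Wo; rewrite -[in U x]phi_range => -[p _ <-] Wp.
have := preim_open (rs_hom_cont phi) (Opens Wo); rewrite open_specE => -[E WE].
have : (phi @^-1` W) p by [].
rewrite WE => -[a Ea pa].
have [g _ sharpK] := phi_sharp (@subset_refl _ U).
exists (g (spec_sec_cst _ a)).
  by apply/germ_unit_value; rewrite /value sharpK; apply/loc_unit_mkloc.
move=> y sy; have := germ_unit_sub sy; rewrite -[in U y]phi_range => -[q _ qy].
move: sy; rewrite -qy germ_unit_value /value sharpK => /loc_unit_mkloc qa.
suff : (phi @^-1` W) q by [].
by rewrite WE; exists a.
Qed.

Lemma compact_affine_subproof : compact U.
Proof.
rewrite -[U : set X]phi_range; apply: continuous_compact.
  by apply: continuous_subspaceT; exact: rs_hom_cont.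
exact: compact_spec.
Qed.

End AffineOpen.

Section Affine.
Variables (X : ringed_space) (U : opens X).
Hypothesis U_affine : is_affine_open U.

Lemma germ_unitD x (s t : sec U) :
  U x -> germ_unit x (s + t) -> germ_unit x s \/ germ_unit x t.
Proof.
case: U_affine => A [phi [i r o b]].
exact: (germ_unitD_subproof i r o b).
Qed.

Lemma germ_unit0 x : U x -> ~ germ_unit x (0 : sec U).
Proof.
case: U_affine => A [phi [i r o b]].
exact: (germ_unit0_subproof i r o b).
Qed.

Lemma germ_unit_basis x (W : set X) : open W -> U x -> W x ->
  exists2 s : sec U, germ_unit x s & forall y, germ_unit y s -> W y.
Proof.
case: U_affine => A [phi [i r o b]].
exact: (germ_unit_basis_subproof i r o b).
Qed.

Lemma compact_affine : compact U.
Proof.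
by case: U_affine => A [phi [_ r _ _]]; exact: compact_affine_subproof r.
Qed.

End Affine.

(** * Generic stabilization over the base *)

(* compact_cover is only available for pointed spaces. *)
Lemma compact_finite_cover (T : topologicalType) (A : set T) (U : T -> set T) :
  compact A -> (forall x, open (U x)) -> (forall x, U x x) ->
  exists s : seq T, forall y, A y -> exists2 x, x \in s & U x y.
Proof.
move=> cA Uo Ux; apply: contrapT => ncov.
(* These sets contain [A] up to finitely many [U x]. Without a finite cover the filter is proper,
   but it contains the complement of each [U x], so it has no cluster point. *)
pose F : set_system T := [set B | exists s : seq T,
  forall y, A y -> B y \/ exists2 x, x \in s & U x y].
have FF : ProperFilter F.
  split; first by move=> [s sP]; apply: ncov; exists s => y /sP[].
  split=> [|B C [s sP] [t tP]|B C BC [s sP]].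
  - by exists [::] => y _; left.
  - exists (s ++ t) => y Ay; case: (sP y Ay) => [By|[x xs Uy]]; last first.
      by right; exists x; rewrite ?mem_cat ?xs.
    case: (tP y Ay) => [Cy|[x xt Uy]]; first by left.
    by right; exists x; rewrite ?mem_cat ?xt ?orbT.
  - by exists s => y /sP[/BC|]; [left|right].
have FA : F A by exists [::] => y; left.
have [x [Ax clx]] := cA F FF FA.
have FnU : F (~` U x).
  exists [:: x] => y _; have [Uy|] := pselect (U x y); last by left.
  by right; exists x; rewrite ?mem_head.
by have [y []] := clx _ _ FnU (open_nbhs_nbhs (conj (Uo x) (Ux x))).
Qed.

Section Stabilization.
Variables (X S : scheme) (f : scheme_hom X S) (T : set S) (Z : nat -> set X).
Hypothesis Z_closed : forall n, closed (Z n).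
Hypothesis Z_decr : forall m n, (m <= n)%N -> Z n `<=` Z m.

(** As [Z] decreases, this one inclusion makes the chain constant from [N] on over the given part of
    [X]. *)
Definition stabilizes_over (U : set X) (W : set S) (N : nat) : Prop :=
  forall n x, (N <= n)%N -> U x -> W (f x) -> T (f x) -> Z N x -> Z n x.

Lemma stabilizes_overS (U : set X) (W W' : set S) N N' :
  W' `<=` W -> (N <= N')%N -> stabilizes_over U W N -> stabilizes_over U W' N'.
Proof.
move=> W'W NN' st n x N'n Ux /W'W Wx Tx /(Z_decr NN').
exact: st (leq_trans NN' N'n) Ux Wx Tx.
Qed.

Lemma chart_stabilizes (U : opens X) (V : opens S)
    (h : U `<=` opens_preim (rs_hom_cont f) V) (W : set S) :
  is_affine_open U -> is_affine_open V ->
  finite_type_ring_hom (sharp_res h) -> open W -> W `&` T !=set0 ->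
  exists W' N, [/\ open W', W' `<=` W, W' `&` T !=set0 &
    stabilizes_over U W' N].
Proof.
move=> Uaff Vaff ft Wo WT.
have [[y [[Wy Ty] Vy]]|disj] := pselect (W `&` T `&` V !=set0); last first.
  exists W, 0%N; split=> // n x _ Ux Wx Tx _; case: disj.
  by exists (f x); split; [|exact: (h x)].
(* [J] and [I n] are vanishing ideals, of [T] in [V] and of the part of [Z n] above [T] in [U]:
   vanishing means having a non-unit germ. *)
pose J : set (sec V) := [set a | forall y, T y -> ~ germ_unit y a].
pose I n : set (sec U) :=
  [set b | forall x, U x -> T (f x) -> Z n x -> ~ germ_unit x b].
(* The locus of [a0] lies inside [W], hence so does that of [a0 * c]. *)
have [a0 ya0 a0W] := germ_unit_basis Vaff Wo Vy Wy.
have Ja0 : ~ J a0 by move=> /(_ _ Ty).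
have [||||m n|c [N [Jc stab]]] :=
  @generic_stabilization _ _ _ J I ft _ _ _ _ _ _ Ja0.
- by move=> n a Ja x Ux Tx _ /(germ_unit_sharp_res h _ Ux); exact: Ja.
- by move=> n x Ux _ _; exact: germ_unit0.
- move=> n b b' Ib Ib' x Ux Tx Zx /(germ_unitD Uaff Ux)[].
    exact: Ib.
  exact: Ib'.
- by move=> n b b' Ib' x Ux Tx Zx /germ_unitMr; exact: Ib'.
- by move=> mn b Ib x Ux Tx /(Z_decr mn); exact: Ib.
exists [set y | germ_unit y (a0 * c)], N; split.
- exact: germ_unit_open.
- by move=> z /=; rewrite mulrC => /germ_unitMr /a0W.
- apply: contrapT => H; apply: Jc => z Tz zu; apply: H.
  by exists z; split.
move=> n x Nn Ux Wx Tx ZNx; apply: contrapT => Znx.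
(* [b] vanishes on [Z n] but not at [x]. Times a power of [a0 * c] it lies in [I N], yet its germ at
   [x], a point of [Z N], is still a unit. *)
have [b xb bZ] := germ_unit_basis Uaff (closed_openC (@Z_closed n)) Ux Znx.
have Ib : I n b by move=> y' _ _ Zy' /bZ.
have [k Ik] := stab n b Nn Ib; apply: (Ik x) => //.
by apply: germ_unitM => //; apply: germ_unitX; apply/germ_unit_sharp_res.
Qed.

Lemma charts_stabilize (I : eqType) (U : I -> opens X) (s : seq I) (W : set S) :
  (forall i (W : set S), open W -> W `&` T !=set0 ->
    exists W' N, [/\ open W', W' `<=` W, W' `&` T !=set0 &
      stabilizes_over (U i) W' N]) ->
  open W -> W `&` T !=set0 ->
  exists W' N, [/\ open W', W' `<=` W, W' `&` T !=set0 &
    forall i, i \in s -> stabilizes_over (U i) W' N].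
Proof.
move=> chart; elim: s W => [|i s IH] W Wo WT; first by exists W, 0%N; split.
have [W1 [N1 [W1o W1W W1T st1]]] := chart i W Wo WT.
have [W2 [N2 [W2o W2W1 W2T st2]]] := IH W1 W1o W1T.
exists W2, (maxn N1 N2); split=> // [|j]; first exact: subset_trans W1W.
rewrite inE => /predU1P[->|/st2 stj].
  by apply: stabilizes_overS st1 => //; exact: leq_maxl.
by apply: stabilizes_overS stj => //; exact: leq_maxr.
Qed.

Lemma generically_stabilizes : of_finite_type f -> T !=set0 ->
  exists W N, [/\ open W, W `&` T !=set0 & stabilizes_over setT W N].
Proof.
move=> [lft qc] [y Ty].
(* The final open set is sought inside [V], whose preimage is compact, so finitely many charts cover
   all that lies above it. *)
have [V Vy Vaff] := scheme_affine y.
have cV := qc V (opensP V) (compact_affine Vaff).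
have chart x : exists U : opens X, U x /\ forall (W : set S), open W ->
    W `&` T !=set0 -> exists W' N, [/\ open W', W' `<=` W, W' `&` T !=set0 &
      stabilizes_over U W' N].
  have [U [V' [h [Ux Uaff V'aff ft]]]] := lft x; exists U; split=> // W.
  exact: chart_stabilizes Uaff V'aff ft.
have [U UP] := choice chart.
have [s cov] :=
  compact_finite_cover cV (fun x => opensP (U x)) (fun x => (UP x).1).
have [W [N [Wo WV WT st]]] :=
  charts_stabilize s (fun i => (UP i).2) (opensP V) (ex_intro _ y (conj Vy Ty)).
exists W, N; split=> // n x Nn _ Wx Tx ZNx.
have [i si Uix] := cov x (WV _ Wx).
exact: st si n x Nn Uix Wx Tx ZNx.
Qed.

End Stabilization.

(** * Noetherian induction on the base *)

(** Without a minimal set, choice yields a strictly decreasing sequence of stable closed sets. *)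
Lemma exists_minimal_stable_closed (G : Type) (T : topologicalType)
    (a : G -> T -> T) (P : set T -> Prop) :
  G_noetherian a -> (exists Z, [/\ closed Z, stable a Z & P Z]) ->
  exists Z, [/\ closed Z, stable a Z, P Z &
    forall Z', closed Z' -> stable a Z' -> P Z' -> Z' `<=` Z -> Z' = Z].
Proof.
move=> noeth [Z0 Z0P]; apply: contrapT => nomin.
pose Q := {Z : set T | [/\ closed Z, stable a Z & P Z]}.
have next (q : Q) : {q' : Q | sval q' `<=` sval q & sval q' <> sval q}.
  suff /cid2[q'] : exists2 q' : Q, sval q' `<=` sval q & sval q' <> sval q.
    by exists q'.
  case: q => Z [Zc Zs ZP] /=; apply: contrapT => H; apply: nomin.
  exists Z; split=> // Z' Z'c Z's Z'P Z'Z; apply: contrapT => Z'ne; apply: H.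
  have Z'Q : [/\ closed Z', stable a Z' & P Z'] by [].
  by exists (exist (fun Z => [/\ closed Z, stable a Z & P Z]) Z' Z'Q).
pose q := fix q i : Q := if i is i'.+1 then s2val (next (q i'))
  else exist (fun Z => [/\ closed Z, stable a Z & P Z]) Z0 Z0P.
have [|||N /(_ N.+1 (leqnSn N))] := noeth (fun n => sval (q n)).
- by move=> n; case: (svalP (q n)).
- by move=> n; case: (svalP (q n)).
- by move=> n; exact: s2valP (next (q n)).
- exact: s2valP' (next (q N)).
Qed.

Section Action.
Variables (G : groupType) (X : scheme) (a : scheme_action G X).

Lemma action1 x : a 1%g x = x.
Proof. by rewrite (act1 a). Qed.

Lemma actionM g h x : a (g * h)%g x = a g (a h x).
Proof. by rewrite (actM a). Qed.

Lemma actionVK g x : a (g^-1)%g (a g x) = x.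
Proof. by rewrite -actionM mulVg action1. Qed.

Lemma open_translates (W : set X) :
  open W -> open [set x | exists g, W (a g x)].
Proof.
move=> Wo; have -> : [set x | exists g, W (a g x)] = \bigcup_g (a g @^-1` W).
  by rewrite eqEsubset; split=> x [g] //; exists g.
apply: bigcup_open => g _.
exact: (preim_open (rs_hom_cont (a g)) (Opens Wo)).
Qed.

End Action.

Theorem theorem1p1 (G : groupType) (X S : scheme)
    (aX : scheme_action G X) (aS : scheme_action G S) (f : scheme_hom X S) :
  equivariant aX aS f ->
  of_finite_type f ->
  topologically_G_noetherian aS ->
  topologically_G_noetherian aX.
Proof.
move=> equiv ft noeth Z Zc Zs Zd.
have f_act g x : f (aX g x) = aS g (f x).
  exact: (congr1 (fun u : scheme_hom X S => u x) (equiv g)).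
have Zdecr m n : (m <= n)%N -> Z n `<=` Z m.
  by move=> /subnK<-; elim: (n - m)%N => //= k IH x /Zd /IH.
suff [N ZN] : exists N, stabilizes_over f setT Z setT setT N.
  exists N => n Nn; rewrite eqEsubset; split; first exact: Zdecr.
  by move=> x; exact: ZN.
apply: contrapT => nstab.
pose P T := ~ exists N, stabilizes_over f T Z setT setT N.
have [|T [Tc Ts PT Tmin]] := @exists_minimal_stable_closed _ _ _ P noeth.
  by exists setT; split=> //; exact: closedT.
have [T0|T0] := pselect (T !=set0); last first.
  by apply: PT; exists 0%N => n x _ _ _ Tx; case: T0; exists (f x).
have [W [N [Wo [y [Wy Ty]] st]]] := generically_stabilizes Zc Zdecr ft T0.
(* [T'] misses [y], so by minimality of [T] the chain stabilizes over it. *)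
pose T' := T `&` ~` [set y | exists g, W (aS g y)].
have T'T : T' `<=` T by exact: subIsetl.
have T'c : closed T'.
  by apply: closedI => //; apply: open_closedC; exact: open_translates.
have T's : stable (fun g : G => aS g : S -> S) T'.
  move=> g _ [z [Tz Wz] <-]; split; first by apply: (Ts g); exists z.
  by move=> [h Wh]; apply: Wz; exists (h * g)%g; rewrite actionM.
have [N' st'] : exists N', stabilizes_over f T' Z setT setT N'.
  apply: contrapT => PT'; have T'E := Tmin T' T'c T's PT' T'T.
  have [_] : T' y by rewrite T'E.
  by apply; exists 1%g; rewrite action1.
apply: PT; exists (maxn N N') => n x; rewrite geq_max => /andP[Nn N'n] _ _ Tx Zx.
have [[g Wg]|nW] := pselect (exists g, W (aS g (f x))); last first.
  by apply: (st' n x N'n) => //; exact: Zdecr (leq_maxr _ _) _ Zx.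
(* The point [aX g x] lies above [W], where the chain is constant from [N] on; stability of [Z n]
   under the inverse of [g] brings this back to [x]. *)
rewrite -(actionVK aX g x); apply: (Zs n (g^-1)%g); exists (aX g x) => //.
apply: (st n (aX g x) Nn) => //; rewrite ?f_act //.
  by apply: (Ts g); exists (f x).
apply: (Zs N g); exists x => //; exact: Zdecr (leq_maxl _ _) _ Zx.
Qed.
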